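(* Let $(P,\omega)$ be a sign-graded labeled poset with $p$ elements and rank $r$. Then $W(P,\omega;t)\in S_+^{p-r-1}$; that is, $$W(P,\omega;t)=\sum_{i=0}^{\lfloor (p-r-1)/2\rfloor}a_i\,t^i(1+t)^{p-r-1-2i}$$ with all $a_i\ge0$.
   Context: A labeled poset is a finite nonempty poset $P$ with $p$ elements and a bijection $\omega:P\to\{1,\dots,p\}$. Write $x\prec y$ if $y$ covers $x$; $\omega$ induces $\epsilon(x,y)=1$ if $\omega(x)<\omega(y)$ and $-1$ otherwise on covering pairs. $(P,\omega)$ is sign-graded if $\sum_{i=1}^n\epsilon(x_{i-1},x_i)$ is the same for every maximal chain $x_0\prec\cdots\prec x_n$ of $P$; this common value is the rank $r$. The $W$-polynomial is $W(P,\omega;t)=\sum_{\pi\in\mathcal{L}(P,\omega)}t^{\mathrm{des}(\pi)}$, where $\mathcal{L}(P,\omega)$ is the set of permutations $\omega(x_1)\cdots\omega(x_p)$ for linear extensions $x_1,\dots,x_p$ of $P$ and $\mathrm{des}(\pi)$ is the number of $i$ with $\pi_i>\pi_{i+1}$. $S^d_+$ denotes the set of non-negative linear combinations of $t^i(1+t)^{d-2i}$, $0\le i\le\lfloor d/2\rfloor$. *)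

(* Defs.v *)
From HB Require Import structures.
From mathcomp Require Import all_boot all_order all_algebra.
Set Implicit Arguments. Unset Strict Implicit. Unset Printing Implicit Defensive.
Import Order.TTheory GRing.Theory Num.Theory.
Local Open Scope order_scope.

Section LabeledPoset.
Variables (d : Order.disp_t) (T : finPOrderType d).

Definition covers (x y : T) : bool :=
  (x < y) && [forall z : T, ~~ ((x < z) && (z < y))].

(* Labeling omega : T -> 'I_#|T| (labels 0..p-1 instead of 1..p; only the
   relative order of labels matters). *)
Variable omega : T -> 'I_#|T|.

Definition eps (x y : T) : int := if (omega x < omega y)%N then 1%R else (-1)%R.

Definition maximal_chain (x0 : T) (s : seq T) : bool :=
  [&& path covers x0 s,
      [forall z : T, ~~ (z < x0)] &
      [forall z : T, ~~ (last x0 s < z)]].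

Definition chain_sign (x0 : T) (s : seq T) : int :=
  (\sum_(pr <- zip (x0 :: s) s) eps pr.1 pr.2)%R.

Definition sign_graded_rank (r : int) : Prop :=
  forall x0 s, maximal_chain x0 s -> chain_sign x0 s = r.

Definition linext (f : {ffun 'I_#|T| -> T}) : bool :=
  injectiveb f && [forall i, forall j, (f i < f j) ==> (i < j)%N].

Definition des (s : seq nat) : nat :=
  (\sum_(i < (size s).-1) (nth 0 s i.+1 < nth 0 s i))%N.

Definition word (f : {ffun 'I_#|T| -> T}) : seq nat :=
  [seq (nat_of_ord (omega (f i))) | i <- enum 'I_#|T|].

Definition Wpoly : {poly rat} :=
  (\sum_(f : {ffun 'I_#|T| -> T} | linext f) 'X^(des (word f)))%R.

End LabeledPoset.

Definition in_Splus (dd : int) (f : {poly rat}) : Prop :=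
  exists2 n : nat, dd = Posz n &
    exists a : nat -> rat, (forall i, 0 <= a i)%R /\
      f = (\sum_(i < n./2.+1) a i *: ('X^i * (1 + 'X) ^+ (n - 2 * i)))%R.

(* Main.v *)
(* A rank function rho turns a (P, omega)-partition sigma into sigma + (rho - rho')/2,
   an (P, omega')-partition for any other sign-graded labeling of P whose rank
   function rho' has the same parity. Hence order polynomials of two such labelings
   are translates of each other, and their W-polynomials differ by a power of t. It
   thus suffices to treat the labeling in which elements of even rank precede those
   of odd rank. There, a linear extension is a sequence of maximal runs of constant
   parity; each run is an antichain whose elements may be permuted freely, so
   summing over the first run gives
     W_a(S) = sum_B A_B(t) t^a W_(1-a)(S \ B),
   with A_B an Eulerian polynomial. Splitting a permutation at its largest letter,
     A_(n+1) = (1 + t) A_n + t sum_(0 < k < n) C(n, k) A_k A_(n-k),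
   shows that A_n lies in S_+^(n-1), and the degrees add up. *)
Require Import Defs.
From HB Require Import structures.
From mathcomp Require Import all_boot all_order all_algebra.
From mathcomp Require Import zify.
Set Implicit Arguments. Unset Strict Implicit. Unset Printing Implicit Defensive.
Import Order.TTheory GRing.Theory Num.Theory.

(** * Gamma-positive polynomials *)

Section GammaPositivity.
Local Open Scope ring_scope.

(* The degree is an integer so that the zero polynomial is allowed in every
   degree, which makes the degree bookkeeping free of truncated subtraction. *)
Inductive gamma_pos : int -> {poly rat} -> Prop :=
| gamma_pos0 n : gamma_pos n 0
| gamma_posM n c i k : n = (i.*2 + k)%:Z -> 0 <= c ->
    gamma_pos n (c *: ('X^i * (1 + 'X) ^+ k))
| gamma_posD n f g : gamma_pos n f -> gamma_pos n g -> gamma_pos n (f + g).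

Lemma gamma_pos_sum (I : Type) (r : seq I) (P : pred I) n (F : I -> {poly rat}) :
  (forall i, P i -> gamma_pos n (F i)) -> gamma_pos n (\sum_(i <- r | P i) F i).
Proof.
by move=> FP; apply: big_ind => //; [exact: gamma_pos0 | exact: gamma_posD].
Qed.

Lemma gamma_pos_mul m n f g :
  gamma_pos m f -> gamma_pos n g -> gamma_pos (m + n) (f * g).
Proof.
move=> fP; elim: fP n g => {m f} [m|m c i k -> c0|m f1 f2 _ IH1 _ IH2] n g gP.
- by rewrite mul0r; exact: gamma_pos0.
- elim: gP => {n g} [n|n c' i' k' -> c'0|n g1 g2 _ IH1 _ IH2].
  + by rewrite mulr0; exact: gamma_pos0.
  + rewrite -scalerAl -scalerAr scalerA mulrACA -!exprD.
    by apply: gamma_posM; [lia | exact: mulr_ge0].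
  + by rewrite mulrDr; exact: gamma_posD.
- by rewrite mulrDl; apply: gamma_posD; [exact: IH1 | exact: IH2].
Qed.

Lemma gamma_pos1 : gamma_pos 0 1.
Proof.
by have := @gamma_posM 0 1 0 0 erefl ler01; rewrite !expr0 mulr1 scale1r.
Qed.

Lemma gamma_posX : gamma_pos 2%:Z 'X.
Proof.
by have := @gamma_posM 2%:Z 1 1 0 erefl ler01; rewrite expr0 expr1 mulr1 scale1r.
Qed.

Lemma gamma_pos1X : gamma_pos 1%:Z (1 + 'X).
Proof.
by have := @gamma_posM 1%:Z 1 0 1 erefl ler01; rewrite expr0 expr1 mul1r scale1r.
Qed.

Lemma gamma_posXn m : gamma_pos m.*2%:Z 'X^m.
Proof.
have := @gamma_posM m.*2%:Z 1 m 0 _ ler01.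
by rewrite expr0 mulr1 scale1r addn0; apply.
Qed.

Lemma gamma_pos_coef_ge0 n f j : gamma_pos n f -> 0 <= f`_j.
Proof.
elim=> {n f} [n|n c i k _ c0|n f g _ f0 _ g0].
- by rewrite coef0.
- rewrite coefZ coefXnM; apply: mulr_ge0 => //; case: ifP => // _.
  elim: k (j - i)%N => [|k IH] [|l]; rewrite ?expr0 ?coef1 // exprS mulrDl mul1r.
    by rewrite coefD coefXM addr0.
  by rewrite coefD coefXM addr_ge0.
- by rewrite coefD addr_ge0.
Qed.

(** Coefficients are non-negative, so nothing cancels: a coefficient that vanishes in a sum vanishes
    in both summands, and every basis term with nonzero [c] already has [m <= i]. *)
Lemma gamma_pos_divXn n m f : gamma_pos n f -> (forall j, (j < m)%N -> f`_j = 0) ->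
  exists2 g, gamma_pos (n - m.*2%:Z) g & f = 'X^m * g.
Proof.
elim=> {n f} [n|n c i k -> c0|n f1 f2 f1P IH1 f2P IH2] fj.
- by exists 0; [exact: gamma_pos0 | rewrite mulr0].
- have [c_eq0|c_neq0] := eqVneq c 0.
    by exists 0; [exact: gamma_pos0 | rewrite c_eq0 scale0r mulr0].
  have mi : (m <= i)%N.
    rewrite leqNgt; apply/negP => im; move/eqP: (fj _ im).
    rewrite coefZ coefXnM ltnn subnn -horner_coef0 !hornerE expr1n mulr1.
    by rewrite (negPf c_neq0).
  exists (c *: ('X^(i - m) * (1 + 'X) ^+ k)).
    by apply: gamma_posM => //; lia.
  by rewrite -scalerAr mulrA -exprD subnKC.
- have h j : (j < m)%N -> f1`_j = 0 /\ f2`_j = 0.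
    move=> /fj /eqP; rewrite coefD paddr_eq0; last exact: gamma_pos_coef_ge0 f2P.
      by case/andP => /eqP-> /eqP->.
    exact: gamma_pos_coef_ge0 f1P.
  have [g1 g1P ->] := IH1 (fun j jm => (h j jm).1).
  have [g2 g2P ->] := IH2 (fun j jm => (h j jm).2).
  by exists (g1 + g2); [exact: gamma_posD | rewrite mulrDr].
Qed.

Lemma gamma_pos_XnM n m f :
  gamma_pos n ('X^m * f) -> gamma_pos (n - m.*2%:Z) f.
Proof.
move=> XfP; case: (gamma_pos_divXn (m := m) XfP) => [j jm|g gP].
  by rewrite coefXnM jm.
have Xm0 : 'X^m != 0 :> {poly rat} by rewrite monic_neq0 ?monicXn.
by move/(mulfI Xm0) => ->.
Qed.

Lemma gamma_pos_Splus n f : gamma_pos n f -> 0 <= n -> in_Splus n f.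
Proof.
case: n => // n fP _; exists n => //.
move: fP; move En : (Posz n) => m fP.
elim: fP En => {m f} [m|m c i k -> c0|m f1 f2 _ IH1 _ IH2] En.
- exists (fun=> 0); split=> //; rewrite big1 // => i _; exact: scale0r.
- have {En} -> : n = (i.*2 + k)%N by lia.
  have ik : (i < (i.*2 + k)./2.+1)%N by lia.
  exists (fun j => if j == i then c else 0); split=> [j|]; first by case: ifP.
  rewrite (bigD1 (Ordinal ik)) //= eqxx big1 ?addr0.
    by congr (_ *: (_ * _ ^+ _)); lia.
  by move=> j; rewrite -val_eqE /= => /negPf ->; rewrite scale0r.
- have [a1 [a1P ->]] := IH1 En; have [a2 [a2P ->]] := IH2 En.
  exists (fun j => a1 j + a2 j); split=> [j|]; first exact: addr_ge0.
  by rewrite -big_split; apply: eq_bigr => j _; rewrite scalerDl.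
Qed.

End GammaPositivity.

(** * Order polynomials *)

Section OrderPolynomial.
Variables (I : finType) (E : rel I).
Implicit Types w : I -> I -> nat.

(* [w x y] is 1 where the partition has to increase strictly and 0 elsewhere. *)
Definition is_part w n (s : {ffun I -> 'I_n}) :=
  [forall x, forall y, E x y ==> (s x + w x y <= s y)].

Definition parts w n := #|[set s : {ffun I -> 'I_n} | is_part w s]|.

Lemma is_partP w n (s : {ffun I -> 'I_n}) :
  reflect (forall x y, E x y -> s x + w x y <= s y) (is_part w s).
Proof.
apply: (iffP forallP) => [H x y Exy|H x].
  by have /forallP/(_ y)/implyP := H x; apply.
by apply/forallP => y; apply/implyP; exact: H.
Qed.

(** [s + h] is weakly increasing along [E], so its bounds need checking only at one suitable [z]
    below and one above each [x]. Adding [h] is then an injection from the [w1]-partitions into the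
    [w2]-partitions. *)
Lemma parts_shift w1 w2 n1 n2 (h : I -> int) (i0 : I) :
  (forall x y, E x y -> h y - h x = (w2 x y)%:Z - (w1 x y)%:Z)%R ->
  (forall x, exists2 z, connect E z x & 0 <= h z)%R ->
  (forall x, exists2 z, connect E x z & h z <= n2%:Z - n1%:Z)%R ->
  parts w1 n1 <= parts w2 n2.
Proof.
move=> hE hlo hhi.
have mono (s : {ffun I -> 'I_n1}) x y : is_part w1 s -> connect E x y ->
    ((s x)%:Z + h x <= (s y)%:Z + h y)%R.
  move=> /is_partP sP /connectP [p pth ->]; elim: p x pth => //= z p IH x.
  case/andP => Exz /IH; have := sP _ _ Exz; have := hE _ _ Exz; lia.
have range (s : {ffun I -> 'I_n1}) x : is_part w1 s ->
    (0 <= (s x)%:Z + h x < n2%:Z)%R.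
  move=> sP; have [z zx hz] := hlo x; have [z' xz' hz'] := hhi x.
  have := mono s _ _ sP zx; have := mono s _ _ sP xz'.
  have := ltn_ord (s z'); lia.
have [s0 s0P|none] := pickP (@is_part w1 n1); last first.
  by rewrite /parts eq_card0 // => s; rewrite inE none.
(* An empty target range is excluded by the value at [i0]; [inord] needs a successor. *)
case: n2 => [|n2] in hhi range *; first by have := range _ i0 s0P; lia.
pose F (s : {ffun I -> 'I_n1}) := [ffun x => inord (absz ((s x)%:Z + h x)%R)] : {ffun I -> 'I_n2.+1}.
have FE s x : is_part w1 s -> ((F s x)%:Z = (s x)%:Z + h x)%R.
  by move=> sP; rewrite ffunE inordK; have := range s x sP; lia.
rewrite /parts -(@card_in_imset _ _ F); last first.
  move=> s t; rewrite !inE => sP tP Fst; apply/ffunP => x; apply: val_inj => /=.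
  by have := FE s x sP; have := FE t x tP; rewrite Fst; lia.
apply: subset_leq_card; apply/subsetP => _ /imsetP [s + ->].
rewrite !inE => sP; apply/is_partP => x y Exy.
have := FE s x sP; have := FE s y sP; have := hE x y Exy.
by have /is_partP/(_ x y Exy) := sP; lia.
Qed.

End OrderPolynomial.

(** * Descents of words and order polynomials of chains *)

Section Descents.

Lemma des_cons2 a b s : des [:: a, b & s] = (b < a) + des (b :: s).
Proof. by rewrite /des /= big_ord_recl. Qed.

Lemma des_nil : des [::] = 0. Proof. by rewrite /des big_ord0. Qed.

Lemma des1 a : des [:: a] = 0. Proof. by rewrite /des big_ord0. Qed.

Lemma des_cat s a b t :
  des (rcons s a ++ b :: t) = des (rcons s a) + (b < a) + des (b :: t).
Proof.
elim: s => [|c [|e s] IH] /=; first by rewrite des_cons2 des1.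
  by rewrite !des_cons2 des1 !addn0 addnA.
by rewrite des_cons2 /= in IH *; rewrite des_cons2 IH !addnA.
Qed.

(** The guard [k.+1 < size s] keeps the default value 0 of [nth] from counting as a descent past the
    end. *)
Lemma des_take s k : des (take k.+2 s) =
  des (take k.+1 s) + ((k.+1 < size s) && (nth 0 s k.+1 < nth 0 s k)).
Proof.
elim: s k => [|a [|b s] IH] k; rewrite ?des_nil //=; first by rewrite addn0.
case: k => [|k]; first by rewrite take0 des_cons2 !des1 addn0.
by rewrite !des_cons2 -[b :: take k.+1 s]/(take k.+2 (b :: s)) IH addnA.
Qed.

End Descents.

(** This is the number of multisets of size [p] drawn from [n] values; only its vanishing at 0 and
    its positivity at 1 are used as numerical facts. *)
Definition multichains p n :=
  parts (fun i j : 'I_p => j == i.+1 :> nat) (fun _ _ => 0) n.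

Section Chain.
Variables (p : nat) (p_gt0 : 0 < p).

Lemma multichains0 : multichains p 0 = 0.
Proof.
apply/eqP; rewrite cards_eq0; apply/eqP/setP => s; rewrite !inE.
by case: (s (Ordinal p_gt0)).
Qed.

Lemma multichains1_gt0 : 0 < multichains p 1.
Proof.
apply/card_gt0P; exists [ffun=> ord0]; rewrite inE.
by apply/is_partP => x y _; rewrite !ffunE.
Qed.

Lemma connect_succ (i j : 'I_p) :
  i <= j -> connect (fun i j : 'I_p => j == i.+1 :> nat) i j.
Proof.
move: j => [j jp] /=; elim: j jp => [|j IH] jp ij.
  by apply/eq_connect0/val_inj => /=; lia.
have [ij'|ji] := leqP i j.
  have jp' : j < p by lia.
  by apply: connect_trans (IH jp' ij') (connect1 _) => /=.
by apply/eq_connect0/val_inj => /=; lia.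
Qed.

(* Subtracting from each value the number of earlier descents turns strict
   inequalities into weak ones and loses [des] values at the top. *)
Lemma parts_chain (a : 'I_p -> nat) n :
  parts (fun i j : 'I_p => j == i.+1 :> nat) (fun i j => a j < a i) n
  = multichains p (n - des [seq a i | i <- enum 'I_p]).
Proof.
set s := [seq a i | i <- enum 'I_p]; set D := des s.
have size_s : size s = p by rewrite size_map size_enum_ord.
have nth_s (i : 'I_p) : nth 0 s i = a i by rewrite (nth_map i) ?size_enum_ord // nth_ord_enum.
pose h (i : 'I_p) := des (take i.+1 s).
have hS (i j : 'I_p) : j == i.+1 :> nat -> h j = h i + (a j < a i).
  move/eqP => ji; have := ltn_ord j.
  by rewrite /h -nth_s -(nth_s i) ji => jp; rewrite des_take size_s jp.
have p1p : p.-1 < p by lia.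
pose i0 := Ordinal p_gt0; pose i1 := Ordinal p1p.
have h0 : h i0 = 0 by rewrite /h; case: (s) => [|b t]; rewrite ?des_nil //= take0 des1.
have h1 : h i1 = D by rewrite /h /i1 /= prednK // -size_s take_size.
have c0 (i : 'I_p) := connect_succ (leq0n i : i0 <= i).
have c1 (i : 'I_p) : connect (fun i j : 'I_p => j == i.+1 :> nat) i i1.
  by apply: connect_succ => /=; have := ltn_ord i; lia.
apply/eqP; rewrite eqn_leq; apply/andP; split.
  apply: (@parts_shift _ _ _ _ _ _ (fun i => - (h i)%:Z)%R i0).
  - by move=> x y /hS; lia.
  - by move=> x; exists i0; rewrite ?c0 ?h0.
  - by move=> x; exists i1; rewrite ?c1 ?h1 //; lia.
(* For [n <= D] the truncated [n - D] is 0 and there is no multichain; otherwise the inverse shift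
   applies. *)
have [nD|Dn] := leqP n D.
  by rewrite (eqP nD) multichains0.
apply: (@parts_shift _ _ _ _ _ _ (fun i => (h i)%:Z)%R i0).
- by move=> x y /hS; lia.
- by move=> x; exists i0; rewrite ?c0 ?h0.
- by move=> x; exists i1; rewrite ?c1 ?h1 //; lia.
Qed.

(* Evaluating at [n = k + 1] isolates the fibre over [k] since
   [multichains p 0 = 0], so the fibre sizes are determined inductively. *)
Lemma multichains_fibers (I : finType) (P Q : pred I) (u v : I -> nat) :
  (forall n, \sum_(i | P i) multichains p (n - u i)
             = \sum_(i | Q i) multichains p (n - v i)) ->
  (\sum_(i | P i) 'X^(u i) = \sum_(i | Q i) 'X^(v i) :> {poly rat})%R.
Proof.
move=> uv.
pose cnt (A : pred I) (w : I -> nat) k := \sum_(i | A i) (w i == k : nat).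
have fib (A : pred I) w n : \sum_(i | A i) multichains p (n - w i)
    = \sum_(k < n) cnt A w k * multichains p (n - k).
  under [RHS]eq_bigr do rewrite big_distrl /=.
  rewrite exchange_big; apply: eq_bigr => i _ /=.
  have [wn|nw] := ltnP (w i) n.
    rewrite (bigD1 (Ordinal wn)) //= eqxx mul1n big1 ?addn0 // => k.
    by rewrite -val_eqE /= eq_sym => /negPf ->.
  rewrite (eqP nw) multichains0 big1 // => k _.
  by rewrite gtn_eqF ?mul0n // (leq_trans _ nw).
have cntE k : cnt P u k = cnt Q v k.
  have [m] := ubnP k; elim: m k => // m IH k km.
  have := uv k.+1; rewrite !fib !big_ord_recr /= subSnn.
  rewrite (eq_bigr (fun i : 'I_k => cnt Q v i * multichains p (k.+1 - i))).
    by move/addnI/eqP; rewrite eqn_pmul2r ?multichains1_gt0 // => /eqP.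
  by move=> i _; rewrite IH // (leq_trans (ltn_ord i)).
apply/polyP => k.
have coefE (A : pred I) w : ((\sum_(i | A i) 'X^(w i) : {poly rat})`_k
    = (cnt A w k)%:R)%R.
  by rewrite coef_sum natr_sum; apply: eq_bigr => i _; rewrite coefXn eq_sym.
by rewrite !coefE cntE.
Qed.

End Chain.

(** * Cover relations and saturated chains *)

Section Covers.
Variables (d : Order.disp_t) (T : finPOrderType d).
Local Open Scope order_scope.

Lemma covers_lt (x y : T) : covers x y -> x < y.
Proof. by case/andP. Qed.

(** Induction on the number of elements above [x] and up to [y]: among the elements strictly
    between, one with the fewest elements between [x] and itself covers [x]. *)
Lemma le_connect_covers (x y : T) : x <= y -> connect (@covers d T) x y.
Proof.
have [n] := ubnP #|[set z | x < z <= y]|.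
elim: n x => // n IH x; rewrite ltnS => size_xy.
rewrite le_eqVlt => /orP [/eqP-> //|xy].
have [xy_cov|] := boolP (covers x y); first exact: connect1.
rewrite /covers xy negb_forall => /existsP [z0].
rewrite negbK => z0P.
pose height z := #|[set t : T | (x < t) && (t < z)]|.
have [z /andP [xz zy] zmin] := @arg_minnP _ z0 (fun z => (x < z) && (z < y)) height z0P.
have xz_cov : covers x z.
  rewrite /covers xz; apply/forallP => t; apply/negP => /andP [xt tz].
  have ty := lt_trans tz zy.
  have := zmin t; rewrite xt ty leqNgt => /(_ isT)/negP; apply.
  apply/proper_card/properP; split.
    by apply/subsetP => u; rewrite !inE => /andP [-> /lt_trans ->].
  by exists t; rewrite !inE ?xt ?tz ?ltxx.
apply: connect_trans (connect1 xz_cov) (IH z _ (ltW zy)).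
apply: leq_trans size_xy; apply/proper_card/properP; split.
  by apply/subsetP => u; rewrite !inE => /andP [/(lt_trans xz) -> ->].
by exists z; rewrite !inE ?xz ?(ltW zy) ?ltxx.
Qed.

(** [R] may be irreflexive, so the induction along a saturated chain ends at its last cover rather
    than at the empty chain. *)
Lemma lt_covers_ind (R : rel T) : transitive R ->
  (forall x y, covers x y -> R x y) -> forall x y, x < y -> R x y.
Proof.
move=> Rtr Rcov x y xy; have /connectP [s sP yE] := le_connect_covers (ltW xy).
elim: s x sP yE xy => [|z s IH] x /=; first by move=> _ ->; rewrite ltxx.
case/andP => /Rcov Rxz zs yE _; move: (zs) => /path_sorted _.
case: s IH zs yE => [|t s] IH zs yE; first by rewrite yE.
apply: Rtr Rxz (IH z zs yE _); rewrite yE /=.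
have lt_zs : path <%O z (t :: s) by apply: sub_path zs => u v /covers_lt.
have /andP [zt ts] := lt_zs.
rewrite (lt_le_trans zt) //.
have /(order_path_min le_trans) /allP ts' : path <=%O t s.
  by apply: sub_path ts => u v /ltW.
by have := mem_last t s; rewrite inE => /predU1P [-> //|/ts'].
Qed.

Lemma minimal_below (x : T) :
  exists2 z, z <= x & [forall t : T, ~~ (t < z)].
Proof.
have [z zx zmin] := @arg_minnP _ x (fun z : T => z <= x) (fun z => #|[set t : T | t < z]|) (lexx x).
exists z => //; apply/forallP => t; apply/negP => tz.
have := zmin t (le_trans (ltW tz) zx); rewrite leqNgt => /negP; apply.
apply/proper_card/properP; split.
  by apply/subsetP => u; rewrite !inE => /lt_trans; apply.
by exists t; rewrite !inE ?tz ?ltxx.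
Qed.

Lemma maximal_above (x : T) :
  exists2 z, x <= z & [forall t : T, ~~ (z < t)].
Proof.
have [z zx zmin] := @arg_minnP _ x (fun z : T => x <= z) (fun z => #|[set t : T | z < t]|) (lexx x).
exists z => //; apply/forallP => t; apply/negP => tz.
have := zmin t (le_trans zx (ltW tz)); rewrite leqNgt => /negP; apply.
apply/proper_card/properP; split.
  by apply/subsetP => u; rewrite !inE => /(lt_trans tz).
by exists t; rewrite !inE ?tz ?ltxx.
Qed.

End Covers.

(** * Partitions of a labeled poset and its linear extensions *)

Section LinearExtensions.
Variables (d : Order.disp_t) (T : finPOrderType d).
Local Notation p := #|T|.
Variable (L : T -> nat).
Hypotheses (L_inj : injective L) (T_nonempty : 0 < p).

(** With these weights on covers, [parts] counts order-preserving (P, omega)-partitions, strict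
    exactly where the label drops. *)
Definition strict_at (x y : T) : nat := L y < L x.

Definition label_word (f : {ffun 'I_p -> T}) := [seq L (f i) | i <- enum 'I_p].

Section FixPartition.
Variables (n : nat) (s : {ffun T -> 'I_n}).

Let lexlt (x y : T) := (s x < s y) || (s x == s y) && (L x < L y).
Let lexle (x y : T) := (s x < s y) || (s x == s y) && (L x <= L y).

Let lexlt_trans : transitive lexlt.
Proof. by move=> y x z; rewrite /lexlt -!val_eqE /=; lia. Qed.

Let lexlt_irr : irreflexive lexlt.
Proof. by move=> x; rewrite /lexlt; lia. Qed.

Let lexle_total : total lexle.
Proof. by move=> x y; rewrite /lexle -!val_eqE /=; lia. Qed.

Let lexltE x y : lexlt x y = (x != y) && lexle x y.
Proof.
have [->|xy] := eqVneq x y; first by rewrite lexlt_irr.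
have : L x != L y by rewrite inj_eq.
by rewrite /lexlt /lexle /=; lia.
Qed.

(** A tie of [s] is allowed precisely where the label increases, which is how the lexicographic
    order breaks ties. *)
Let lexlt_strict x y : x != y -> lexlt x y = (s x + strict_at x y <= s y).
Proof.
move=> xy; have : L x != L y by rewrite inj_eq.
by rewrite /lexlt /strict_at -val_eqE /=; lia.
Qed.

Let codomE (f : {ffun 'I_p -> T}) : codom f = [seq f i | i <- enum 'I_p].
Proof. by []. Qed.

Let nth_codom (x0 : T) (f : {ffun 'I_p -> T}) (i : 'I_p) : nth x0 (codom f) i = f i.
Proof. by rewrite codomE (nth_map i) ?size_enum_ord // nth_ord_enum. Qed.

Let is_part_sorted (f : {ffun 'I_p -> T}) : injective f ->
  is_part (fun i j : 'I_p => j == i.+1 :> nat) (fun i j => strict_at (f i) (f j))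
    [ffun i => s (f i)] = sorted lexlt (codom f).
Proof.
move=> f_inj; apply/is_partP/idP => [H|fs i j ij].
  case E : (codom f) => [//|x0 t]; rewrite -E; apply/(sortedP x0) => i.
  rewrite size_map size_enum_ord => ip; have ip' := ltnW ip.
  rewrite (nth_codom x0 f (Ordinal ip)) (nth_codom x0 f (Ordinal ip')) lexlt_strict.
    by have := H (Ordinal ip') (Ordinal ip) (eqxx _); rewrite !ffunE.
  by rewrite inj_eq // -val_eqE /=; lia.
rewrite !ffunE -lexlt_strict; last first.
  by rewrite inj_eq // -val_eqE /= (eqP ij) neq_ltn leqnn.
have /sortedP/(_ i) := fs => /(_ (f i)); rewrite size_map size_enum_ord -(eqP ij).
by move/(_ (ltn_ord j)); rewrite !nth_codom.
Qed.

(* Sorting by [(s x, L x)] lexicographically selects the linear extension to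
   which a partition belongs. *)
Lemma is_part_linext :
  is_part (@covers d T) strict_at s =
  \sum_(f | linext f) is_part (fun i j : 'I_p => j == i.+1 :> nat)
    (fun i j => strict_at (f i) (f j)) [ffun i => s (f i)] :> nat.
Proof.
have sortedE f : linext f -> is_part (fun i j : 'I_p => j == i.+1 :> nat)
    (fun i j => strict_at (f i) (f j)) [ffun i => s (f i)] = sorted lexlt (codom f).
  by case/andP => /injectiveP f_inj _; exact: is_part_sorted.
rewrite (eq_bigr (fun f : {ffun _} => sorted lexlt (codom f) : nat)); last first.
  by move=> f /sortedE ->.
have lin_cov (f : {ffun 'I_p -> T}) (i j : 'I_p) : sorted lexlt (codom f) ->
    (i < j)%N -> lexlt (f i) (f j).
  move=> fs ij; have := sorted_ltn_nth lexlt_trans (f i) fs.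
  move/(_ i j); rewrite !inE size_map size_enum_ord !ltn_ord !nth_codom.
  by apply.
(* A linear extension sorted by [lexlt] lists the two ends of every cover in [lexlt] order, which
   would make [s] a partition. *)
have [sP|sNP] := boolP (is_part _ _ s); last first.
  rewrite big1 // => f fl; apply/eqP; rewrite eqb0; apply: contraNN sNP => fs.
  have /andP [/injectiveP f_inj /forallP f_mono] := fl.
  have /(_ _)/mapP f_surj x : x \in codom f.
    by apply: inj_card_onto f_inj _ x; rewrite card_ord.
  apply/is_partP => x y xy; have /covers_lt ltxy := xy.
  have [i _ xE] := f_surj x; have [j _ yE] := f_surj y; subst x y.
  rewrite -lexlt_strict ?(lt_eqF ltxy) //; apply: lin_cov fs _.
  by have /forallP/(_ j)/implyP := f_mono i; apply.
pose g := sort lexle (enum T).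
have size_g : size g = p by rewrite size_sort cardE.
have g_uniq : uniq g by rewrite sort_uniq enum_uniq.
have g_sorted : sorted lexlt g.
  have : sorted (fun x y => (x != y) && lexle x y) g.
    case E : g => [//|x0 t]; rewrite -E; apply/(sortedP x0) => i ig.
    rewrite nth_uniq ?(ltnW ig) // neq_ltn ltnSn /=.
    by have /(sortedP x0) := sort_sorted lexle_total (enum T); apply.
  by rewrite (eq_sorted lexltE).
have /card_gt0P [x0 _] := T_nonempty.
pose f := [ffun i : 'I_p => nth x0 g i].
have codom_f : codom f = g.
  apply: (@eq_from_nth _ x0); rewrite size_map size_enum_ord // => i ip.
  by rewrite (nth_codom x0 f (Ordinal ip)) ffunE.
have f_inj : injective f.
  move=> i j; rewrite !ffunE => /eqP; rewrite nth_uniq ?size_g // => /eqP.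
  exact: val_inj.
have lt_lex x y : (x < y)%O -> lexlt x y.
  apply: (lt_covers_ind lexlt_trans) => {}x {}y xy.
  rewrite lexlt_strict; first by have /is_partP := sP; apply.
  by rewrite lt_eqF ?covers_lt.
have f_lin : linext f.
  apply/andP; split; first exact/injectiveP.
  apply/forallP => i; apply/forallP => j; apply/implyP => /lt_lex fij.
  rewrite ltnNge; apply/negP; rewrite leq_eqVlt => /predU1P [/val_inj ji|ji].
    by rewrite ji lexlt_irr in fij.
  have := lexlt_trans (lin_cov f _ _ _ ji) fij.
  by rewrite codom_f lexlt_irr => /(_ g_sorted).
(* Uniqueness: two lists of the same elements, both sorted by a transitive irreflexive relation,
   coincide. *)
rewrite (bigD1 f) //= codom_f g_sorted big1 // => f' /andP [f'l f'f].
apply/eqP; rewrite eqb0; apply: contraNN f'f => f's; apply/eqP.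
have /andP [/injectiveP f'_inj _] := f'l.
have codomEq : codom f' = codom f.
  rewrite codom_f; apply: (irr_sorted_eq lexlt_trans lexlt_irr f's g_sorted) => x.
  rewrite mem_sort mem_enum inE.
  by apply: inj_card_onto f'_inj _ x; rewrite card_ord.
by apply/ffunP => i; rewrite -(nth_codom x0) codomEq nth_codom.
Qed.

End FixPartition.

(** After exchanging the sums over partitions and linear extensions, transport along the bijection
    [f] leaves the partitions of a chain labeled by the word of [f]. *)
Lemma parts_linext n :
  parts (@covers d T) strict_at n =
  \sum_(f | linext f) multichains p (n - des (label_word f)).
Proof.
rewrite /parts -sum1_card big_mkcond /=.
rewrite (eq_bigr _ (fun s _ => _ : _ = (is_part (@covers d T) strict_at s : nat))); last first.
  by move=> s; rewrite inE; case: is_part.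
rewrite (eq_bigr _ (fun s _ => is_part_linext s)) exchange_big /=.
apply: eq_bigr => f /andP [/injectiveP f_inj _].
rewrite -(parts_chain T_nonempty (fun i => L (f i))) /parts -sum1_card [RHS]big_mkcond /=.
have [f' fK f'K] : bijective f by apply: inj_card_bij f_inj _; rewrite card_ord.
rewrite (reindex (fun s : {ffun 'I_p -> 'I_n} => [ffun x => s (f' x)])) /=; last first.
  apply: onW_bij; exists (fun s : {ffun T -> 'I_n} => [ffun i => s (f i)]).
    by move=> s; apply/ffunP => i; rewrite !ffunE fK.
  by move=> s; apply/ffunP => i; rewrite !ffunE f'K.
apply: eq_bigr => s _; rewrite inE.
have -> : [ffun i => [ffun x => s (f' x)] (f i)] = s.
  by apply/ffunP => i; rewrite !ffunE fK.
by rewrite /strict_at; case: is_part.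
Qed.

End LinearExtensions.

(** * Changing the labeling *)

Section Relabeling.
Variables (d : Order.disp_t) (T : finPOrderType d).
Local Notation p := #|T|.
Hypothesis T_nonempty : 0 < p.

(** Labels are arbitrary naturals because the parity-separating labeling may exceed [p]; for the
    values of [omega] this is convertible to [Wpoly omega]. *)
Definition label_poly (L : T -> nat) : {poly rat} :=
  (\sum_(f : {ffun 'I_p -> T} | linext f) 'X^(des (label_word L f)))%R.

(** Shifts by [h] and [- h] show that the order polynomial of [L2] at [n] is that of [L1] at
    [n - m]. Expanded over linear extensions, this raises every exponent by [m]. *)
Lemma label_poly_shift (L1 L2 : T -> nat) (h : T -> int) (m : nat) :
  injective L1 -> injective L2 ->
  (forall x y, covers x y ->
    h y - h x = (strict_at L2 x y)%:Z - (strict_at L1 x y)%:Z)%R ->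
  (forall z, [forall t : T, ~~ (t < z)%O] -> h z = 0%R) ->
  (forall z, [forall t : T, ~~ (z < t)%O] -> h z = Posz m) ->
  label_poly L2 = ('X^m * label_poly L1)%R.
Proof.
move=> L1_inj L2_inj hcov hmin hmax.
have /card_gt0P [x0 _] := T_nonempty.
have below x : exists2 z, connect (@covers d T) z x & h z = 0%R.
  by have [z /le_connect_covers zx /hmin] := minimal_below x; exists z.
have above x : exists2 z, connect (@covers d T) x z & h z = Posz m.
  by have [z /le_connect_covers zx /hmax] := maximal_above x; exists z.
have partsE n : parts (@covers d T) (strict_at L2) n
              = parts (@covers d T) (strict_at L1) (n - m).
  apply/eqP; rewrite eqn_leq; apply/andP; split.
    apply: (@parts_shift _ _ _ _ _ _ (fun x => - h x)%R x0).
    - by move=> x y /hcov; lia.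
    - by move=> x; have [z zx hz] := below x; exists z; rewrite ?hz.
    - by move=> x; have [z zx hz] := above x; exists z; rewrite ?hz //; lia.
  have [nm|mn] := leqP n m.
    rewrite (eqP nm) (parts_linext L1_inj T_nonempty) big1 // => f _.
    by rewrite multichains0.
  apply: (@parts_shift _ _ _ _ _ _ h x0) => //.
  - by move=> x; have [z zx hz] := below x; exists z; rewrite ?hz.
  - by move=> x; have [z zx hz] := above x; exists z; rewrite ?hz //; lia.
rewrite /label_poly mulr_sumr; under [RHS]eq_bigr do rewrite -exprD.
apply: (multichains_fibers T_nonempty) => n.
rewrite -(parts_linext L2_inj T_nonempty) partsE (parts_linext L1_inj T_nonempty).
by apply: eq_bigr => f _; rewrite subnDA.
Qed.

End Relabeling.

(** * The rank function of a sign-graded poset *)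

Section Rank.
Variables (d : Order.disp_t) (T : finPOrderType d) (omega : T -> 'I_#|T|) (r : int).
Hypothesis hsg : forall x0 s, maximal_chain x0 s -> chain_sign omega x0 s = r.
Local Open Scope order_scope.

Lemma chain_sign_cons (x y : T) s :
  chain_sign omega x (y :: s) = (eps omega x y + chain_sign omega y s)%R.
Proof. by rewrite /chain_sign /= big_cons. Qed.

Lemma chain_sign_nil (x : T) : chain_sign omega x [::] = 0%R.
Proof. by rewrite /chain_sign big_nil. Qed.

Lemma chain_sign_cat (x : T) s t :
  chain_sign omega x (s ++ t) =
  (chain_sign omega x s + chain_sign omega (last x s) t)%R.
Proof.
elim: s x => [|y s IH] x; first by rewrite chain_sign_nil add0r.
by rewrite !chain_sign_cons IH addrA.
Qed.

Lemma down_chain (x : T) : exists z s,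
  [/\ [forall t : T, ~~ (t < z)], path (@covers d T) z s & last z s = x].
Proof.
have [z /le_connect_covers/connectP [s zs xE] zmin] := minimal_below x.
by exists z, s.
Qed.

Lemma up_chain (x : T) : exists s,
  path (@covers d T) x s && [forall t : T, ~~ (last x s < t)].
Proof.
have [z /le_connect_covers/connectP [s xs zE] zmax] := maximal_above x.
by exists s; rewrite xs -zE.
Qed.

(** [rho x] is [r] minus the sign of one chosen saturated chain from [x] up to a maximal element.
    Splicing such chains with a chain from below gives maximal chains, so the choice does not affect
    the value. *)
Lemma rank_function : exists rho : T -> int,
  [/\ forall x y, covers x y -> (rho y - rho x)%R = eps omega x y,
      forall z, [forall t : T, ~~ (t < z)] -> rho z = 0%R
    & forall z, [forall t : T, ~~ (z < t)] -> rho z = r].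
Proof.
pose up x := xchoose (up_chain x).
have upP x : path (@covers d T) x (up x) && [forall t : T, ~~ (last x (up x) < t)].
  exact: (xchooseP (up_chain x)).
have signE z s t x : [forall t : T, ~~ (t < z)] -> path (@covers d T) z s ->
    last z s = x -> path (@covers d T) x t && [forall u : T, ~~ (last x t < u)] ->
    (chain_sign omega z s + chain_sign omega x t)%R = r.
  move=> zmin zs xE /andP [xt tmax]; subst x.
  rewrite -chain_sign_cat; apply: hsg.
  by apply/and3P; split=> //; rewrite ?cat_path ?zs ?last_cat.
exists (fun x => (r - chain_sign omega x (up x))%R); split.
(* One chain from below is completed by [up x] and by [y :: up y]; both totals are [r]. *)
- move=> x y xy; have [z [s [zmin zs sx]]] := down_chain x.
  have sxE := signE z s (up x) x zmin zs sx (upP x).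
  have [upy_path upy_max] := andP (upP y).
  have := signE z s (y :: up y) x zmin zs sx; rewrite /= xy upy_path upy_max.
  move/(_ isT); rewrite chain_sign_cons; move: sxE; set a := chain_sign _ _ _.
  by set b := chain_sign _ _ _; set c := chain_sign _ _ _; lia.
- move=> z zmin; have := signE z [::] (up z) z zmin isT erefl (upP z).
  by rewrite chain_sign_nil add0r => ->; rewrite subrr.
- move=> x xmax; have [z [s [zmin zs sx]]] := down_chain x.
  have := signE z s (up x) x zmin zs sx (upP x).
  have := signE z s [::] x zmin zs sx; rewrite /= xmax chain_sign_nil addr0.
  by move=> /(_ isT) ->; set a := chain_sign _ _ _; lia.
Qed.

(** A maximal chain with [k] steps has [k + 1] distinct elements and sign at most [k]. This makes
    the degree [#|T| - r - 1] non-negative. *)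
Lemma rank_lt_card : (0 < #|T|)%N -> (r < #|T|%:Z)%R.
Proof.
case/card_gt0P => x _; have [z [s [zmin zs sx]]] := down_chain x.
have /andP [xt tmax] := xchooseP (up_chain x); set t := xchoose _ in xt tmax.
have zst : path (@covers d T) z (s ++ t) by rewrite cat_path zs sx.
rewrite -(@hsg z (s ++ t)); last first.
  by apply/and3P; split=> //; rewrite last_cat sx.
have size_le : (size (z :: s ++ t) <= #|T|)%N.
  rewrite -(card_uniqP _) ?max_card //; apply: (sorted_uniq lt_trans ltxx).
  by apply: sub_path zst => u v /covers_lt.
apply: le_lt_trans (_ : (size (s ++ t))%:Z < _)%R => //.
elim: (s ++ t) (z) => [|y u IH] w; first by rewrite chain_sign_nil.
rewrite chain_sign_cons; have := IH y; rewrite /eps /=; case: ifP => _; lia.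
Qed.

End Rank.

(** * Permutations of a set as words *)

Section Words.
Variable T : finType.
Implicit Types (S B C U : {set T}) (u v w z : seq T).

Definition words S := permutations (enum S).

Lemma wordsP S w : reflect (uniq w /\ w =i S) (w \in words S).
Proof.
rewrite mem_permutations; apply: (iffP idP) => [wS|[w_uniq wS]].
  by split=> [|x]; rewrite ?(perm_uniq wS) ?enum_uniq // (perm_mem wS) mem_enum.
by apply: uniq_perm => // [|x]; rewrite ?enum_uniq // mem_enum.
Qed.

Lemma size_words S w : w \in words S -> size w = #|S|.
Proof. by rewrite mem_permutations cardE => /perm_size. Qed.

Lemma words_glue S B C z : perm_eq (enum B ++ z ++ enum C) (enum S) ->
  perm_eq [seq w <- words S | (take #|B| w \in words B)
                               && (take (size z) (drop #|B| w) == z)]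
          [seq u ++ z ++ v | u <- words B, v <- words C].
Proof.
move=> BCS; apply: uniq_perm; first exact/filter_uniq/permutations_uniq.
  apply: allpairs_uniq; rewrite ?permutations_uniq // => -[u v] [u' v'].
  case/allpairsP=> -[u1 v1] /= [/size_words su _ [-> ->]].
  case/allpairsP=> -[u2 v2] /= [/size_words su' _ [-> ->]] /=.
  by move/eqP; rewrite !eqseq_cat ?su ?su' // eqxx => /andP [/eqP-> /eqP->].
move=> w; rewrite mem_filter; apply/idP/allpairsP.
  case/andP=> /andP [uB /eqP zE] wS.
  have wE : w = take #|B| w ++ z ++ drop (size z) (drop #|B| w).
    by rewrite -{1}zE !cat_take_drop.
  exists (take #|B| w, drop (size z) (drop #|B| w)); split=> //=.
  move: wS uB; rewrite !mem_permutations => wS uB.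
  rewrite perm_sym in BCS; have := perm_trans wS BCS; rewrite {1}wE.
  have /permPl -> := perm_cat uB (perm_refl (z ++ drop (size z) (drop #|B| w))).
  by rewrite !perm_cat2l.
case=> -[u v] /= [uB vC ->]; have su := size_words uB.
rewrite -su take_size_cat // drop_size_cat // take_size_cat // eqxx uB /=.
move: uB vC; rewrite !mem_permutations => uB vC.
apply: perm_trans BCS; apply: perm_cat => //.
by rewrite perm_cat2l.
Qed.

(** The separator [z] is [[:: x]] when a permutation is split at its largest letter and empty when a
    first parity run is removed. [P] must force the cut and then depend on the tail alone, through
    [Q]. *)
Lemma sum_words_glue (R : nmodType) S B C z (P Q : pred (seq T)) (F : seq T -> R) :
  perm_eq (enum B ++ z ++ enum C) (enum S) ->
  (forall w, w \in words S -> P w ->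
    (take #|B| w \in words B) && (take (size z) (drop #|B| w) == z)) ->
  {in words B & words C, forall u v, P (u ++ z ++ v) = Q v} ->
  (\sum_(w <- words S | P w) F w =
   \sum_(u <- words B) \sum_(v <- words C | Q v) F (u ++ z ++ v))%R.
Proof.
move=> BCS Pcut PQ.
pose cut w := (take #|B| w \in words B) && (take (size z) (drop #|B| w) == z).
transitivity (\sum_(w <- words S | cut w && P w) F w)%R.
  rewrite big_seq_cond [RHS]big_seq_cond; apply: eq_bigl => w.
  have [wS /=|//] := boolP (w \in words S).
  by have [/(Pcut w wS)|] := boolP (P w); rewrite /cut ?andbF // => ->.
rewrite -big_filter_cond (perm_big _ (words_glue BCS)) big_mkcond.
rewrite big_allpairs_dep; apply: eq_big_seq => u uB.
rewrite [RHS]big_mkcond; apply: eq_big_seq => v vC.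
by rewrite PQ.
Qed.

Lemma words0 : words set0 = [:: [::]].
Proof. by rewrite /words enum_set0. Qed.

Lemma words_nilp S w : w \in words S -> nilp w = (S == set0).
Proof. by move/size_words => wS; rewrite -cards_eq0 -wS. Qed.

End Words.

(** * Eulerian polynomials *)

Section Eulerian.
Variables (T : finType) (L : T -> nat).
Hypothesis L_inj : injective L.
Implicit Types (S B C U : {set T}) (u v w z : seq T).

Definition desl w := des [seq L x | x <- w].

Lemma desl_cat w x y v : desl (rcons w x ++ y :: v)
  = desl (rcons w x) + (L y < L x) + desl (y :: v).
Proof. by rewrite /desl map_cat map_rcons /= des_cat. Qed.

Lemma desl_cons x y v : desl [:: x, y & v] = (L y < L x) + desl (y :: v).
Proof. by rewrite /desl /= des_cons2. Qed.

(** The step into [x] is an ascent, and the step out of it, if there is one, is a descent. *)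
Lemma desl_max u x v : {in u, forall y, L y < L x} -> {in v, forall y, L y < L x} ->
  desl (u ++ x :: v) = desl u + (~~ nilp v + desl v).
Proof.
move=> ux vx.
have xv : desl (x :: v) = ~~ nilp v + desl v.
  case: v vx => [|y v] vx; first by rewrite /desl /= des1 des_nil.
  by rewrite desl_cons vx ?mem_head.
case/lastP: u ux => [|u y] ux; first by rewrite /= xv /desl des_nil.
rewrite desl_cat xv ltnNge (ltnW (ux y _)) ?addn0 //.
by rewrite mem_rcons mem_head.
Qed.

Local Open Scope ring_scope.

(** This is the Eulerian polynomial with constant term 1. It depends only on [#|S|], but indexing by
    sets lets letters be removed without relabeling. *)
Definition eulerian S : {poly rat} := \sum_(w <- words S) 'X^(desl w).

Lemma eulerian0 : eulerian set0 = 1.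
Proof. by rewrite /eulerian words0 big_seq1 /desl des_nil. Qed.

(** [U] is the set of letters before the largest letter [x]; the exponent records the descent after
    [x], absent when nothing follows. *)
Lemma eulerian_rec S x : x \in S -> {in S, forall y, L y <= L x}%N ->
  eulerian S = \sum_(U : {set T} | U \subset S :\ x)
    eulerian U * ('X^(S :\ x :\: U != set0) * eulerian (S :\ x :\: U)).
Proof.
move=> xS xmax.
have ltx y : y \in S :\ x -> (L y < L x)%N.
  by rewrite !inE ltn_neqAle inj_eq // => /andP [-> /xmax ->].
pose K w := [set y in take (index x w) w].
rewrite /eulerian big_seq_cond.
rewrite (partition_big K (fun U => U \subset S :\ x)) /=; last first.
  move=> w; rewrite andbT => /wordsP [w_uniq wS]; apply/subsetP => y.
  rewrite !inE => yw; rewrite -wS (mem_take yw) andbT.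
  have [xw|] := boolP (x \in w); last by rewrite wS xS.
  move: w_uniq; rewrite -{1}(cat_take_drop (index x w) w) cat_uniq.
  case/and3P=> _ /hasPn/(_ x) + _; rewrite (drop_nth x) ?index_mem // nth_index //.
  by rewrite mem_head => /(_ isT) /= xn; apply/eqP => yx; case/negP: xn; rewrite -{1}yx.
apply: eq_bigr => U US.
have xU : x \notin U by apply: contraTN US => xU; apply/subsetPn; exists x; rewrite ?inE ?eqxx.
set C := S :\ x :\: U.
have xC : x \notin C by rewrite !inE eqxx andbF.
rewrite (@sum_words_glue T _ S U C [:: x] _ xpredT); first last.
- move=> u v /[dup] uU /wordsP [u_uniq uE] /[dup] vC /wordsP [v_uniq vE].
  have xu : x \notin u by rewrite uE.
  have uvS : u ++ [:: x] ++ v \in words S.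
    apply/wordsP; split.
      rewrite cat_uniq u_uniq /= negb_or xu vE xC v_uniq !andbT /=.
      by apply/hasPn => y; rewrite vE in_setD /= uE => /andP [].
    move=> y; rewrite mem_cat inE uE vE !inE.
    have [->|yx] /= := eqVneq y x; first by rewrite xS orbT.
    by have [/(subsetP US)|//] := boolP (y \in U); rewrite !inE => /andP [_ ->].
  rewrite uvS /K index_cat (negPf xu) /= eqxx addn0 take_size_cat //=.
  by apply/eqP/setP => y; rewrite inE uE.
- move=> w wS; rewrite wS /= /K => /eqP UE; have /wordsP [w_uniq wE] := wS.
  have xw : x \in w by rewrite wE.
  have uU : take (index x w) w \in words U.
    by apply/wordsP; split=> [|y]; rewrite ?take_uniq // -UE inE.
  have := size_words uU; rewrite size_takel ?index_size // => <-.
  by rewrite uU /= (drop_nth x) ?index_mem // nth_index //= take0 eqxx.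
- apply: uniq_perm; rewrite ?enum_uniq //.
    rewrite cat_uniq /= !enum_uniq negb_or !mem_enum xU xC !andbT /=.
    by apply/hasPn => y; rewrite /= !mem_enum in_setD => /andP [].
  move=> y; rewrite !mem_cat !mem_enum !inE.
  have [->|yx] /= := eqVneq y x; first by rewrite xS orbT.
  by have [/(subsetP US)|//] := boolP (y \in U); rewrite !inE => /andP [_ ->].
rewrite mulr_suml; apply: eq_big_seq => u /wordsP [_ uE].
rewrite !mulr_sumr; apply: eq_big_seq => v vC.
have /wordsP [_ vE] := vC.
rewrite desl_max ?exprD ?(words_nilp vC) // => y.
  by rewrite uE => yU; apply/ltx/(subsetP US).
by rewrite vE in_setD => /andP [_ /ltx].
Qed.

Lemma gamma_pos_eulerian S : S != set0 -> gamma_pos (#|S|%:Z - 1) (eulerian S).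
Proof.
have [n] := ubnP #|S|; elim: n S => // n IH S SleN /set0Pn [x0 x0S].
have [x xS xmax] := @arg_maxnP _ x0 (mem S) L x0S.
have {}xS : x \in S := xS.
rewrite (eulerian_rec xS xmax).
have cardS : #|S| = #|S :\ x|.+1 by rewrite (cardsD1 x S) xS.
have IHR U : U \subset S :\ x -> U != set0 -> gamma_pos (#|U|%:Z - 1) (eulerian U).
  move=> US; apply: IH; apply: leq_ltn_trans (subset_leq_card US) _.
  by rewrite -cardS.
move: IHR; set R := S :\ x; move=> IHR.
(* With a single letter the two extreme choices of [U] coincide, so this case is separate. *)
have [R0|R0] := eqVneq R set0.
  apply: gamma_pos_sum => U; rewrite R0 subset0 => /eqP ->.
  rewrite setDv eqxx !eulerian0 /= expr0 !mulr1 cardS -/R R0 cards0.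
  exact: gamma_pos1.
have RP := IHR R (subxx _) R0.
(* Alone, the terms for [U] empty and [U = R] have the wrong centre of symmetry; together they give
   [1 + 'X] times the polynomial of [R]. *)
rewrite (bigD1 set0) ?sub0set //= (bigD1 R) ?subxx //= addrA.
apply: gamma_posD.
  rewrite setD0 R0 eulerian0 mul1r setDv eqxx eulerian0 /= expr0 !mulr1 expr1.
  have -> : (#|S|%:Z - 1 = 1 + (#|R|%:Z - 1))%R by rewrite cardS /R; lia.
  have -> : 'X * eulerian R + eulerian R = (1 + 'X) * eulerian R.
    by rewrite mulrDl mul1r addrC.
  exact: gamma_pos_mul gamma_pos1X RP.
apply: gamma_pos_sum => U /andP [/andP [UR U0] UnR].
have RU0 : R :\: U != set0.
  by apply: contra UnR; rewrite setD_eq0 => RU; rewrite eqEsubset UR.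
have -> : (#|S|%:Z - 1 = (#|U|%:Z - 1) + (2%:Z + (#|R :\: U|%:Z - 1)))%R.
  by rewrite cardS -/R -(cardsID U R) (setIidPr UR); lia.
rewrite RU0; apply: gamma_pos_mul; first exact: IHR.
by apply: gamma_pos_mul; [exact: gamma_posX | apply: IHR => //; exact: subsetDl].
Qed.

End Eulerian.

(** * Labelings separating the parities *)

Section CanonicalLabeling.
Variables (d : Order.disp_t) (T : finPOrderType d) (L : T -> nat).
Variables (q : T -> bool) (b : bool).
Hypotheses (L_inj : injective L)
  (q_covers : forall x y, covers x y -> q y = ~~ q x)
  (q_max : forall z, [forall t : T, ~~ (z < t)%O] -> q z = b)
  (L_q : forall x y, ~~ q x -> q y -> L x < L y).
Implicit Types (S B C U : {set T}) (u v w z : seq T).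

Definition is_lin w := pairwise (fun x y : T => ~~ (y < x)%O) w.

(** The value [false] on the empty word makes [lin_poly a set0] zero, so the end of a word is
    treated apart, through [nilp]. *)
Definition head_is (a : bool) w := if w is x :: _ then q x == a else false.

(** Such sets are what remains of the poset after an initial part of a linear extension. *)
Definition up_closed S := [forall x, forall y, (x \in S) && (x < y)%O ==> (y \in S)].

Lemma up_closedP S : reflect (forall x y, x \in S -> (x < y)%O -> y \in S) (up_closed S).
Proof.
apply: (iffP forallP) => [H x y xS xy|H x].
  by have /forallP/(_ y)/implyP := H x; rewrite xS; apply.
by apply/forallP => y; apply/implyP => /andP []; exact: H.
Qed.

Definition lin_poly a S : {poly rat} :=
  (\sum_(w <- words S | is_lin w && head_is a w) 'X^(desl L w))%R.

(* Two comparable elements of equal parity have an element of the other parity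
   strictly between them. *)
Lemma block_antichain a S B : up_closed S -> B \subset S ->
  {in B, forall x, q x = a} -> up_closed (S :\: B) ->
  {in B &, forall x y, ~~ (x < y)%O}.
Proof.
move=> /up_closedP Sup /subsetP BS qB /up_closedP SBup x y xB yB; apply/negP => xy.
have /connectP [s sP yE] := le_connect_covers (ltW xy).
case: s sP yE => [|z s] /=; first by move=> _ E; rewrite E ltxx in xy.
case/andP=> xz zs yE.
have zB : z \notin B.
  by apply/negP => zB; have := q_covers xz; rewrite !qB //; case: (a).
have zS : z \in S by apply: Sup (BS x xB) (covers_lt xz).
have zy : (z <= y)%O.
  elim: s z {xz zB zS} zs yE => [|t s IH] z /=; first by move=> _ ->.
  by case/andP=> /covers_lt/ltW zt ts yE; apply: le_trans zt (IH _ ts yE).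
move: zy; rewrite le_eqVlt => /predU1P [zy|zy]; first by rewrite zy yB in zB.
by have := SBup z y; rewrite !inE zB zS yB => /(_ isT zy).
Qed.

Let run a w := [set y in take (find (fun x => q x != a) w) w].

Let run_cat a u v : {in u, forall x, q x = a} -> uniq (u ++ v) ->
  (run a (u ++ v) == [set y in u]) = (nilp v || head_is (~~ a) v).
Proof.
move=> qu uv_uniq.
have hasN : has (fun x => q x != a) u = false.
  by apply/hasP => -[x /qu ->]; rewrite eqxx.
rewrite /run find_cat hasN take_cat ltnNge leq_addr /= addKn.
case: v uv_uniq => [|y v] uv_uniq /=; first by rewrite cats0 eqxx.
have [qy|qy] := eqVneq (q y) a; last first.
  by rewrite /= cats0 eqxx; move: qy; case: (q y); case: (a).
rewrite /= qy; have -> : (a == ~~ a) = false by case: (a).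
apply/eqP => /setP/(_ y); rewrite !inE mem_cat mem_head orbT => /esym yu.
by move: uv_uniq; rewrite cat_uniq /= yu /= andbF.
Qed.

(** Only the junction matters: odd elements carry the larger labels, so it is a descent exactly when
    [u] is the odd side. *)
Lemma desl_block (a : bool) u v : {in u, forall x, q x = a} -> ~~ nilp u ->
  head_is (~~ a) v -> desl L (u ++ v) = desl L u + (a + desl L v).
Proof.
case/lastP: u => // u x qu _; case: v => // y v /= /eqP qy.
have qx : q x = a by apply: qu; rewrite mem_rcons mem_head.
rewrite desl_cat -addnA; congr (_ + (_ + _)).
case: (a) qx qy => /= qx qy; first by rewrite L_q ?qx ?qy.
by rewrite ltnNge ltnW // L_q ?qx ?qy.
Qed.

(* The degree correction comes from the parity switches: each switch from odd to
   even is a descent. *)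
Lemma gamma_pos_lin_poly (a : bool) S : up_closed S ->
  gamma_pos (#|S|%:Z - 1 - (b : nat)%:Z + (a : nat)%:Z)%R (lin_poly a S).
Proof.
have [n] := ubnP #|S|; elim: n a S => // n IH a S SleN Sup.
rewrite /lin_poly big_seq_cond.
rewrite (partition_big (run a) (fun B => B \subset S)) /=; last first.
  move=> w /andP [/wordsP [_ wS] _]; apply/subsetP => y.
  by rewrite inE -wS; exact: mem_take.
apply: gamma_pos_sum => B BS.
(* Necessary conditions on the first run of a linear extension; for any other [B] the inner sum is
   empty. *)
pose valid := [&& B != set0, [forall x in B, q x == a] & up_closed (S :\: B)].
have cut w : w \in words S -> is_lin w && head_is a w && (run a w == B) ->
    valid && (take #|B| w \in words B).
  move=> /wordsP [w_uniq wS] /andP [/andP [w_lin w_head] /eqP wB].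
  set k := find (fun x => q x != a) w.
  have uB : take k w \in words B.
    by apply/wordsP; split=> [|y]; rewrite ?take_uniq // -wB inE.
  have uE y : (y \in take k w) = (y \in B) by have /wordsP [_ ->] := uB.
  have -> : take #|B| w \in words B.
    by rewrite -(size_words uB) size_takel ?find_size.
  rewrite andbT; apply/and3P; split.
  - case: (w) w_head @k uB uE => //= x v qx; rewrite qx /= => _ uE.
    by apply/set0Pn; exists x; rewrite -uE mem_head.
  - apply/forall_inP => x; rewrite -uE => xu; apply: contraTT xu => qx.
    apply/negP => /(nthP x) [i]; rewrite size_takel ?find_size // => ik.
    by rewrite nth_take // => xE; have := before_find x ik; rewrite xE qx.
  - apply/up_closedP => x y; rewrite !inE -!uE => /andP [xu xS] xy.
    rewrite ((up_closedP _ Sup) x y) // andbT; apply/negP => yu.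
    have := w_lin; rewrite -(cat_take_drop k w) /is_lin pairwise_cat.
    case/and3P=> /allrelP/(_ y x yu) + _ _; rewrite xy => H.
    have : x \in take k w ++ drop k w by rewrite cat_take_drop wS.
    by rewrite mem_cat (negPf xu) => /H.
have [|nvalid] := boolP valid; last first.
  rewrite big1_seq; first exact: gamma_pos0.
  move=> w /andP [/andP [/andP [wS wP] wB] _].
  by have := cut w wS; rewrite wP wB (negPf nvalid) => /(_ isT).
case/and3P=> B0 /forall_inP qB Cup; set C := S :\: B.
have qBa : {in B, forall x, q x = a} by move=> x /qB /eqP.
rewrite (@sum_words_glue T _ S B C [::] _
  (fun v => is_lin v && (nilp v || head_is (~~ a) v))); first last.
- move=> u v /= /[dup] uB /wordsP [u_uniq uE] /[dup] vC /wordsP [v_uniq vE].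
  have uv_uniq : uniq (u ++ v).
    rewrite cat_uniq u_uniq v_uniq andbT; apply/hasPn => y.
    by rewrite vE /= uE inE => /andP [].
  have -> : u ++ v \in words S.
    apply/wordsP; split=> // y; rewrite mem_cat uE vE inE.
    by have [/(subsetP BS)|] := boolP (y \in B).
  have qu : {in u, forall x, q x = a} by move=> x; rewrite uE; exact: qBa.
  have -> : head_is a (u ++ v).
    case: (u) (words_nilp uB) qu => [|x u'] /=; first by rewrite (negPf B0).
    by move=> _ ->; rewrite ?mem_head.
  have BE : B = [set y in u] by apply/setP => y; rewrite inE uE.
  rewrite [in LHS]BE run_cat // andbT /=; congr (_ && _).
  rewrite /is_lin pairwise_cat.
  have -> : allrel (fun x y : T => ~~ (y < x)%O) u v.
    apply/allrelP => x y; rewrite uE vE => xB yC; apply/negP => yx.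
    by have := (up_closedP _ Cup) y x yC yx; rewrite inE xB.
  (* Every ordering of [B] is admissible because [B] is an antichain. *)
  have /set0Pn [x0 _] := B0; have -> // : pairwise (fun x y : T => ~~ (y < x)%O) u.
  apply/(pairwiseP x0) => i j iu ju _.
  by apply: (block_antichain Sup BS qBa Cup); rewrite -uE mem_nth.
- move=> w wS; rewrite wS => /= wP; rewrite take0 eqxx andbT.
  by have /andP [] := cut w wS wP.
- rewrite /=; apply: uniq_perm; rewrite ?cat_uniq ?enum_uniq ?andbT //=.
    by apply/hasPn => y; rewrite /= !mem_enum inE => /andP [].
  move=> y; rewrite mem_cat !mem_enum inE.
  by have [/(subsetP BS)|] := boolP (y \in B).
(* If nothing remains, [B] contains a maximal element, so the parity of this last run is [b]. *)
have [C0|C0] := eqVneq C set0.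
  have SB : S = B.
    by apply/eqP; rewrite eqEsubset BS andbT -setD_eq0 -/C C0.
  have ab : a = b.
    have /set0Pn [x xB] := B0; have [z xz zmax] := maximal_above x.
    rewrite -(q_max zmax); apply/esym/qBa; rewrite -SB.
    move: xz; rewrite le_eqVlt => /predU1P [<-|]; first by rewrite SB.
    by apply: (up_closedP _ Sup); rewrite SB.
  rewrite C0 words0 SB ab.
  under eq_bigr do rewrite big_cons big_nil /= addr0 cats0.
  have -> : (#|B|%:Z - 1 - (b : nat)%:Z + (b : nat)%:Z = #|B|%:Z - 1)%R by lia.
  exact: gamma_pos_eulerian.
have -> : (\sum_(u <- words B) \sum_(v <- words C | is_lin v && (nilp v || head_is (~~ a) v))
     'X^(desl L (u ++ [::] ++ v)) = eulerian L B * ('X^a * lin_poly (~~ a) C))%R.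
  rewrite mulr_suml; apply: eq_big_seq => u uB.
  rewrite !mulr_sumr big_seq_cond [RHS]big_seq_cond; apply: eq_big => [v|v].
    by have [/words_nilp ->|] := boolP (v \in words C); rewrite ?(negPf C0).
  case/and3P=> /words_nilp -> _; rewrite (negPf C0) /= => vh.
  rewrite (desl_block _ _ vh) ?exprD ?(words_nilp uB) //.
  by have /wordsP [_ uE] := uB => x; rewrite uE; exact: qBa.
have cardS : #|S| = #|B| + #|C| by rewrite -(cardsID B S) (setIidPr BS).
(* The factor ['X^a] counts twice in the degree, which balances the change of the parity correction
   from [~~ a] to [a] and the extra [- 1]. *)
have -> : (#|S|%:Z - 1 - (b : nat)%:Z + (a : nat)%:Z
  = (#|B|%:Z - 1) + ((a : nat).*2%:Z + (#|C|%:Z - 1 - (b : nat)%:Z + (~~ a : nat)%:Z)))%R.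
  by rewrite cardS; case: (a); lia.
apply: gamma_pos_mul; first exact: gamma_pos_eulerian.
apply: gamma_pos_mul; first exact: gamma_posXn.
apply: IH => //; move: SleN; rewrite cardS; move: B0; rewrite -cards_eq0; lia.
Qed.

End CanonicalLabeling.

(** * Linear extensions as words *)

Section WordsOfLinearExtensions.
Variables (d : Order.disp_t) (T : finPOrderType d).
Local Notation p := #|T|.
Hypothesis T_nonempty : 0 < p.

Lemma linext_is_lin (f : {ffun 'I_p -> T}) : linext f = injectiveb f && is_lin (codom f).
Proof.
have /card_gt0P [x0 _] := T_nonempty.
have nth_f (i : 'I_p) : nth x0 (codom f) i = f i.
  by rewrite (nth_map i) ?size_enum_ord // nth_ord_enum.
rewrite /linext; congr (_ && _); apply/forallP/(pairwiseP x0) => [H i j|H i].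
  rewrite !inE size_map size_enum_ord => ip jp ij.
  rewrite (nth_f (Ordinal ip)) (nth_f (Ordinal jp)).
  have /forallP/(_ (Ordinal ip)) := H (Ordinal jp); apply: contraTN => -> /=.
  by rewrite -leqNgt ltnW.
apply/forallP => j; apply/implyP => fij; rewrite ltnNge; apply/negP.
rewrite leq_eqVlt => /predU1P [/val_inj ji|ji]; first by rewrite ji ltxx in fij.
have := H j i; rewrite !inE size_map size_enum_ord !ltn_ord !nth_f fij.
by move/(_ isT isT ji).
Qed.

Lemma label_poly_words (L : T -> nat) :
  label_poly L = (\sum_(w <- words [set: T] | is_lin w) 'X^(desl L w))%R.
Proof.
have /card_gt0P [x0 _] := T_nonempty.
have nth_f (f : {ffun 'I_p -> T}) (i : 'I_p) : nth x0 (codom f) i = f i.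
  by rewrite (nth_map i) ?size_enum_ord // nth_ord_enum.
have codom_words : perm_eq
    [seq codom f | f : {ffun 'I_p -> T} <- index_enum _ & injectiveb f] (words [set: T]).
  apply: uniq_perm; last 1 first.
  - move=> w; apply/mapP/wordsP => [[f]|[w_uniq wT]].
      rewrite mem_filter => /andP [/injectiveP f_inj _ ->]; split=> [|x].
        by rewrite map_inj_uniq ?enum_uniq.
      by rewrite inE; apply: inj_card_onto f_inj _ x; rewrite card_ord.
    have size_w : size w = p.
      by rewrite -cardsT -(card_uniqP w_uniq); apply: eq_card => x; rewrite wT.
    exists [ffun i : 'I_p => nth x0 w i].
      rewrite mem_filter mem_index_enum andbT; apply/injectiveP => i j.
      rewrite !ffunE => /eqP; rewrite nth_uniq ?size_w // => /eqP.
      exact: val_inj.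
    apply: (@eq_from_nth _ x0); rewrite size_w ?size_codom ?card_ord // => i ip.
    by rewrite (nth_f _ (Ordinal ip)) ffunE.
  - rewrite map_inj_in_uniq ?filter_uniq ?index_enum_uniq // => f g _ _ fg.
    by apply/ffunP => i; rewrite -!nth_f fg.
  - exact: permutations_uniq.
rewrite /label_poly (eq_bigl _ _ linext_is_lin) -big_filter_cond.
rewrite -(perm_big _ codom_words) big_map; apply: eq_bigr => f _.
by rewrite /desl /codom /image_mem -map_comp.
Qed.

End WordsOfLinearExtensions.

Theorem theorem4p2 (d : Order.disp_t) (T : finPOrderType d)
  (omega : T -> 'I_#|T|) (omega_inj : injective omega)
  (T_nonempty : (0 < #|T|)%N) (r : int)
  (hsg : sign_graded_rank omega r) :
  in_Splus (Posz #|T| - r - 1)%R (Wpoly omega).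
Proof.
have [rho [rho_covers rho_min rho_max]] := rank_function hsg.
have r_lt := rank_lt_card hsg T_nonempty.
pose q x := (rho x %% 2)%Z == 1%R; pose b := (r %% 2)%Z == 1%R.
(* Adding [#|T|] lifts the odd-rank labels above all even-rank ones and keeps the order of [omega]
   within each parity. *)
pose L x := (q x * #|T| + omega x)%N.
pose omegaN (z : T) : nat := omega z.
have omegaN_inj : injective omegaN.
  by move=> x y /val_inj; exact: omega_inj.
have L_inj : injective L.
  move=> x y; rewrite /L => Lxy; apply: omegaN_inj; rewrite /omegaN.
  have := ltn_ord (omega x); have := ltn_ord (omega y).
  by move: Lxy; case: (q x); case: (q y) => /=; lia.
have q_covers x y : covers x y -> q y = ~~ q x.
  by move/rho_covers; rewrite /q /eps; case: ifP => _; lia.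
have q_max z : [forall t : T, ~~ (z < t)%O] -> q z = b.
  by move/rho_max; rewrite /q /b => ->.
have L_q x y : ~~ q x -> q y -> (L x < L y)%N.
  by rewrite /L => /negPf -> ->; have := ltn_ord (omega x); lia.
have LP : gamma_pos (#|T|%:Z - 1 - (b : nat)%:Z)%R (label_poly L).
  have up : up_closed [set: T] by apply/up_closedP => x y _ _; rewrite inE.
  (* Every linear extension begins with a minimal element, of rank 0, so starting parity [false]
     captures all of them. *)
  have := gamma_pos_lin_poly L_inj q_covers q_max L_q false up.
  rewrite addr0 cardsT label_poly_words // /lin_poly big_seq_cond [in X in _ -> X]big_seq_cond.
  congr gamma_pos; apply: eq_bigl => w; have [/wordsP [_ wT]|//] := boolP (w \in _).
  rewrite /=; case: w wT => [|x w] wT.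
    by have /card_gt0P [x _] := T_nonempty; have := wT x; rewrite !inE.
  rewrite [RHS]/= /is_lin /= andbC; case: allP => [x_min|_] /=; last by rewrite andbF.
  rewrite /q rho_min //; apply/forallP => t; apply/negP => tx.
  have := wT t; rewrite !inE => /predU1P [tE|/x_min]; last by rewrite tx.
  by rewrite tE ltxx in tx.
(* The rank function of [L] is [rho] modulo 2, so half the difference of the two rank functions is
   the floor of half of [rho]. *)
pose h x := (rho x %/ 2)%Z.
have hcov x y : covers x y ->
    (h y - h x = (strict_at L x y)%:Z - (strict_at omegaN x y)%:Z)%R.
  move=> xy; have rhoxy := rho_covers x y xy; have qxy := q_covers x y xy.
  have -> : strict_at L x y = q x.
    rewrite /strict_at; case qx : (q x); first by rewrite L_q ?qxy ?qx.
    by rewrite ltnNge ltnW // L_q ?qxy ?qx.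
  have -> : strict_at omegaN x y = ~~ (omega x < omega y)%N.
    by rewrite /strict_at ltn_neqAle (inj_eq omegaN_inj) gt_eqF ?covers_lt // -leqNgt.
  have : (rho x %% 2)%Z = Posz (q x) by rewrite /q; case: eqP; lia.
  move: rhoxy; rewrite /h /eps; case: ifP => _ /=; case: (q x) => /=; lia.
have hmin z : [forall t : T, ~~ (t < z)%O] -> h z = 0%R.
  by move=> /rho_min; rewrite /h => ->.
have hmax z : [forall t : T, ~~ (z < t)%O] -> h z = (r %/ 2)%Z.
  by move=> /rho_max; rewrite /h => ->.
refine (gamma_pos_Splus _ _); last by lia.
change (gamma_pos (#|T|%:Z - r - 1)%R (label_poly omegaN)).
(* The shift at maximal elements has the sign of [r %/ 2]: a power of ['X] is divided out of the
   polynomial of [L] if it is non-negative, and multiplied in otherwise. *)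
case: (leP 0%R (r %/ 2)%Z) => r0.
  have LE : label_poly L = ('X^`|(r %/ 2)%Z|%N * label_poly omegaN)%R.
    by apply: (label_poly_shift T_nonempty omegaN_inj L_inj hcov hmin) => z /hmax ->; lia.
  rewrite LE in LP; have := gamma_pos_XnM LP.
  by congr gamma_pos; rewrite /b; lia.
have -> : label_poly omegaN = ('X^`|(r %/ 2)%Z|%N * label_poly L)%R.
  apply: (@label_poly_shift _ _ T_nonempty L omegaN (fun x => - h x)%R _ L_inj omegaN_inj).
  - by move=> x y /hcov; lia.
  - by move=> z /hmin ->.
  - by move=> z /hmax ->; lia.
have := gamma_pos_mul (gamma_posXn `|(r %/ 2)%Z|%N) LP.
by congr gamma_pos; rewrite /b; lia.
Qed.
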